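(* Let $p>0$ and assume that there is full $p$-concentration with gap at $1/2$, i.e. for every $c<1$, every symmetric open set $E\subset\mathbb{T}$ containing $1/2$ and every $N>0$ there is $f\in\mathcal{P}$ with gaps larger than $N$ such that $\int_E|f|^p\ge c\int_{\mathbb{T}}|f|^p$. Then there is $p$-concentration; moreover $c_p=1$ and there is full $p$-concentration with gap: for every $c<1$, every nonempty symmetric open set $E\subset\mathbb{T}$ and every $N>0$ there is $f\in\mathcal{P}$ with gaps larger than $N$ such that $\int_E|f|^p\ge c\int_{\mathbb{T}}|f|^p$.
   Context: $\mathbb{T}=\mathbb{R}/\mathbb{Z}$ with Lebesgue measure of total mass $1$; $e(t)=e^{2\pi i t}$; $\mathbb{N}$ denotes the nonnegative integers. $\mathcal{P}$ is the set of idempotents, i.e. of functions $f(x)=\sum_{h\in H}e(hx)$ on $\mathbb{T}$ with $H\subset\mathbb{N}$ finite and nonempty. Such an $f$ has gaps larger than $N$ if consecutive elements of $H$ (in increasing order) differ by more than $N$. A set $E\subset\mathbb{T}$ is symmetric if $x\in E$ implies $-x\in E$. For $p>0$, $c_p$ is the supremum of all constants $c\ge 0$ such that for every nonempty symmetric open set $E\subset\mathbb{T}$ there is $f\in\mathcal{P}$ with $\int_E|f|^p\ge c\int_{\mathbb{T}}|f|^p$; there is $p$-concentration if $c_p>0$. *)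

(* Defs.v *)
From HB Require Import structures.
From mathcomp Require Import all_boot all_order all_algebra.
From mathcomp Require Import finmap.
From mathcomp Require Import all_classical all_reals all_analysis.
From mathcomp Require Import complex.

Set Implicit Arguments.
Unset Strict Implicit.
Unset Printing Implicit Defensive.

Import Order.TTheory GRing.Theory Num.Theory.
Import numFieldNormedType.Exports.

Local Open Scope classical_set_scope.
Local Open Scope complex_scope.
Local Open Scope ring_scope.

(** The torus T = R/Z is handled through the projection R -> R/Z: a subset of T
    is a subset of R stable under translation by 1 (it is open in T iff it is
    open in R, as T has the quotient topology), a function on T is a 1-periodic
    function on R, and the Lebesgue integral over a subset of T is the integral
    over its trace on the fundamental domain [0, 1[. *)

Definition torus_set (R : realType) (E : set R) : Prop :=
  forall x, E (x + 1) <-> E x.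

Definition symmetric_set (R : realType) (E : set R) : Prop :=
  forall x, E x -> E (- x).

Definition symmetric_open (R : realType) (E : set R) : Prop :=
  [/\ torus_set E, open E & symmetric_set E].

(** e(t) = exp(2 i pi t) *)
Definition e (R : realType) (t : R) : R[i] :=
  cos (2 * pi * t) +i* sin (2 * pi * t).

Definition exp_sum (R : realType) (H : {fset nat}) (x : R) : R[i] :=
  \sum_(h <- H) e (h%:R * x).

Definition idempotents (R : realType) : set (R -> R[i]) :=
  [set f | exists2 H : {fset nat}, H != fset0 & f = exp_sum H].

Definition consecutive (H : {fset nat}) (h k : nat) : Prop :=
  [/\ h \in H, k \in H, (h < k)%N
    & forall l : nat, l \in H -> ~~ ((h < l)%N && (l < k)%N)].

Definition gaps_larger (N : nat) (H : {fset nat}) : Prop :=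
  forall h k : nat, consecutive H h k -> (N < k - h)%N.

(** The functions [exp_sum H] determine H (by uniqueness of Fourier
    coefficients), so having gaps larger than N is a property of the function. *)
Definition idempotents_with_gaps (R : realType) (N : nat) : set (R -> R[i]) :=
  [set f | exists H : {fset nat},
    [/\ H != fset0, f = exp_sum H & gaps_larger N H]].

(** The integral of |f|^p over the subset E of the torus. *)
Definition torus_integral (R : realType) (p : R) (f : R -> R[i]) (E : set R) :
    \bar R :=
  (\int[@lebesgue_measure R]_(x in E `&` `[0%R, 1%R[)
      ((Normc.normc (f x)) `^ p)%:E)%E.

Definition concentrated (R : realType) (p c : R) (E : set R) (f : R -> R[i]) :
    Prop :=
  (c%:E * torus_integral p f setT <= torus_integral p f E)%E.

(** For p > 0 the set below contains 0 and is bounded above by 1 (take E to be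
    the whole torus), so [sup] is its least upper bound. *)
Definition concentration_constant (R : realType) (p : R) : R :=
  sup [set c : R | 0 <= c /\
    forall E : set R, symmetric_open E -> E !=set0 ->
      exists2 f, @idempotents R f & concentrated p c E f].

Definition p_concentration (R : realType) (p : R) : Prop :=
  0 < concentration_constant p.

Definition full_p_concentration_with_gap_at_half (R : realType) (p : R) : Prop :=
  forall (c : R) (E : set R) (N : nat),
    c < 1 -> symmetric_open E -> E 2^-1 -> (0 < N)%N ->
    exists2 f, @idempotents_with_gaps R N f & concentrated p c E f.

Definition full_p_concentration_with_gap (R : realType) (p : R) : Prop :=
  forall (c : R) (E : set R) (N : nat),
    c < 1 -> symmetric_open E -> E !=set0 -> (0 < N)%N ->
    exists2 f, @idempotents_with_gaps R N f & concentrated p c E f.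

(* Main.v *)
(** Induct on n: full concentration with gap holds at every point
    k / 2 ^ (n + 1) with k odd, and these points are dense. To pass from 2 b
    to b, take f concentrated at +-2 b; then f(2 x) is concentrated, with equal
    mass, near +-b and near +-(b + 1/2). If b is an odd multiple of 1/4 these
    two pairs coincide. Otherwise multiply by an idempotent R which is much
    smaller at b + 1/2 than at b: since R has gaps and f has much larger gaps,
    f(2 x) R(x) is again an idempotent with gaps. For R take a Riesz product of
    factors 1 + e(j x) with lacunary odd j, all congruent modulo the
    denominator of b, and cos(2 pi j b) > 0: each factor takes the values
    1 + z at b and 1 - z at b + 1/2, where Re z > 0. *)
Require Import Defs.
From mathcomp Require Import all_boot all_order all_algebra.
From mathcomp Require Import finmap zify ring lra.
From mathcomp Require Import all_classical all_reals all_analysis.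
From mathcomp Require Import measurable_realfun complex.

Import Order.TTheory GRing.Theory Num.Theory.
Import numFieldNormedType.Exports.
Import Normc.

Set Implicit Arguments.
Unset Strict Implicit.
Unset Printing Implicit Defensive.

Local Open Scope classical_set_scope.
Local Open Scope complex_scope.
Local Open Scope ring_scope.

(** * Sets of frequencies with gaps *)

Section Gaps.
Local Open Scope fset_scope.
Local Open Scope nat_scope.

(** The least element of [H] above [h] is consecutive to [h] and at most [k], so the gap condition
    passes to all pairs. *)
Lemma gaps_larger_lt N (H : {fset nat}) h k : gaps_larger N H ->
  h \in H -> k \in H -> h < k -> N < k - h.
Proof.
move=> gH hH kH hk.
have exP : exists l, (l \in H) && (h < l) by exists k; rewrite kH.
case: (ex_minnP exP) => l /andP[lH hl] lmin.
have lk : l <= k by apply: lmin; rewrite kH.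
suff : N < l - h by lia.
apply: gH; split=> // i iH; apply/negP => /andP[hi il].
by have := lmin i; rewrite iH hi => /(_ isT); lia.
Qed.

Lemma gaps_larger_fset1 N (k : nat) : gaps_larger N [fset k].
Proof. by move=> h l [/fset1P -> /fset1P ->]; rewrite ltnn. Qed.

Lemma gaps_larger_fset2 N (k : nat) : N < k -> gaps_larger N [fset 0; k].
Proof.
by move=> Nk h l [] /fset2P[]-> /fset2P[]->; rewrite ?ltnn ?ltn0 ?subn0.
Qed.

Lemma gaps_larger_bound M N (H : {fset nat}) : M <= N ->
  gaps_larger N H -> gaps_larger M H.
Proof. by move=> MN gH h k /gH; exact: leq_ltn_trans. Qed.

Lemma fset_nat_bounded (K : {fset nat}) : exists M, forall k, k \in K -> k <= M.
Proof.
exists (\max_(k <- K) k) => k kK.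
by rewrite (big_fsetD1 k)//= leq_maxl.
Qed.

(** Frequency set of [f (d x) g (x)], for [f] and [g] with frequency sets [H] and [K], provided that
    the sums are pairwise distinct. *)
Definition dilate_add d (H K : {fset nat}) : {fset nat} :=
  [fset (d * h + k) | h in H, k in K].

Lemma dilate_addP d (H K : {fset nat}) x :
  reflect (exists h k, [/\ h \in H, k \in K & x = d * h + k])
    (x \in dilate_add d H K).
Proof.
apply: (iffP (imfset2P _ _ _ _ _)) => /=.
  by move=> [h hH [k kK ->]]; exists h, k.
by move=> [h [k [hH kK ->]]]; exists h => //; exists k.
Qed.

Section Separated.
Variables (d M N : nat) (H K : {fset nat}).
Hypotheses (d_gt0 : 0 < d) (gH : gaps_larger (M + N) H).
Hypothesis (KM : forall k, k \in K -> k <= M).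

(** The translates [d * h + K] form separated blocks in the order of the [h]: elements of [H] differ
    by more than [M + N], and a block has length at most [M]. *)
Lemma dilate_add_ltn h h' k k' : h \in H -> h' \in H -> k \in K ->
  h < h' -> N + (d * h + k) < d * h' + k'.
Proof.
move=> hH h'H kK hh'; have := gaps_larger_lt gH hH h'H hh'.
by have := KM kK; nia.
Qed.

Lemma dilate_add_inj h h' k k' : h \in H -> h' \in H -> k \in K -> k' \in K ->
  d * h + k = d * h' + k' -> h = h' /\ k = k'.
Proof.
move=> hH h'H kK k'K E; case: (ltngtP h h') => hh'.
- by have := dilate_add_ltn k' hH h'H kK hh'; lia.
- by have := dilate_add_ltn k h'H hH k'K hh'; lia.
- by split=> //; move: E; rewrite hh' => /addnI.
Qed.

Lemma gaps_larger_dilate_add : gaps_larger N K ->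
  gaps_larger N (dilate_add d H K).
Proof.
move=> gK _ _ [/dilate_addP[h [k [hH kK ->]]] /dilate_addP[h' [k' [h'H k'K ->]]]].
move=> lt _; case: (ltngtP h h') => hh'.
- by have := dilate_add_ltn k' hH h'H kK hh'; lia.
- by have := dilate_add_ltn k h'H hH k'K hh'; lia.
- by move: lt; rewrite hh' => lt; have := gaps_larger_lt gK kK k'K; lia.
Qed.

End Separated.

Lemma dilate_add_neq0 d (H K : {fset nat}) :
  H != fset0 -> K != fset0 -> dilate_add d H K != fset0.
Proof.
move=> /fset0Pn[h hH] /fset0Pn[k kK]; apply/fset0Pn; exists (d * h + k).
by apply/dilate_addP; exists h, k.
Qed.

End Gaps.

(** * Exponential sums *)

Section ExpSum.
Variable R : realType.
Implicit Types (x y : R) (H K : {fset nat}).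

Lemma eD x y : e (x + y) = e x * e y.
Proof.
rewrite /e mulrDr cosD sinD; apply/eqP.
by rewrite eq_complex /= addrC eqxx /= addrC.
Qed.

Lemma e0 : e (0 : R) = 1.
Proof. by rewrite /e mulr0 cos0 sin0. Qed.

Lemma e1 : e (1 : R) = 1.
Proof. by rewrite /e mulr1 mulr_natl cos2pi sin2pi. Qed.

Lemma e_nat n : e (n%:R : R) = 1.
Proof. by elim: n => [|n IHn]; rewrite ?e0// -natr1 eD IHn e1 mulr1. Qed.

Lemma eN x : e (- x) = (e x)^*.
Proof. by rewrite /e mulrN cosN sinN. Qed.

Lemma e_half : e (2^-1 : R) = -1.
Proof.
by rewrite /e mulrAC divff ?pnatr_eq0// mul1r cospi sinpi; apply/eqP;
   rewrite eq_complex /= oppr0 !eqxx.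
Qed.

(** Each sum [d * h + k] arises only once, so the expanded product has coefficients 0 and 1 and is
    again an idempotent. *)
Lemma exp_sum_dilate_add d M N H K x : (0 < d)%N -> gaps_larger (M + N) H ->
  (forall k, k \in K -> (k <= M)%N) ->
  exp_sum (dilate_add d H K) x = exp_sum H (d%:R * x) * exp_sum K x.
Proof.
move=> d0 gH KM; rewrite /exp_sum /dilate_add.
rewrite (@big_imfset2 _ _ _ _ (fun=> nat) _ _ (mem H) (fun=> mem K)
  (fun h k => (d * h + k)%N)) /=.
  rewrite big_distrl /=; apply: eq_bigr => h _.
  rewrite big_distrr /=; apply: eq_bigr => k _.
  by rewrite natrD natrM mulrDl eD mulrCA mulrA.
move=> [h k] [h' k'] /= /andP[/= hH kK] /andP[/= h'H k'K].
by move=> /(dilate_add_inj d0 gH KM hH h'H kK k'K)[-> ->].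
Qed.

Lemma exp_sumD1 H x : exp_sum H (x + 1) = exp_sum H x.
Proof.
by apply: eq_bigr => h _; rewrite mulrDr mulr1 eD e_nat mulr1.
Qed.

Lemma exp_sumN H x : exp_sum H (- x) = (exp_sum H x)^*.
Proof. by rewrite /exp_sum rmorph_sum; apply: eq_bigr => h _; rewrite mulrN eN. Qed.

Lemma normc_conj (z : R[i]) : normc z^* = normc z.
Proof. by case: z => a b /=; rewrite sqrrN. Qed.

Lemma normc_ge0 (z : R[i]) : 0 <= normc z.
Proof. by case: z => a b /=; rewrite sqrtr_ge0. Qed.

Lemma normcX (z : R[i]) n : normc (z ^+ n) = normc z ^+ n.
Proof. by elim: n => [|n IHn]; rewrite ?normc1// !exprS normcM IHn. Qed.

Lemma normc_e x : normc (e x) = 1.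
Proof. by rewrite /= cos2Dsin2 sqrtr1. Qed.

Lemma normc_exp_sum_le H x : normc (exp_sum H x) <= (size H)%:R.
Proof.
rewrite /exp_sum; elim: (H : seq nat) => [|h s IHs]; first by rewrite big_nil normc0.
rewrite big_cons -[size _]add1n natrD.
apply: le_trans (le_normcD (e (h%:R * x)) _) _.
by rewrite normc_e lerD2l.
Qed.

Lemma exp_sum0 H : exp_sum H (0 : R) = (size H)%:R.
Proof.
rewrite /exp_sum; elim: (H : seq nat) => [|h s IHs]; first by rewrite big_nil.
by rewrite big_cons IHs mulr0 e0 nat1r.
Qed.

Lemma continuous_normc_exp_sum H : continuous ((fun x => normc (exp_sum H x)) : R -> R).
Proof.
have reE x : complex.Re (exp_sum H x) = \sum_(h <- H) cos (2 * pi * (h%:R * x)).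
  by rewrite /exp_sum raddf_sum.
have imE x : complex.Im (exp_sum H x) = \sum_(h <- H) sin (2 * pi * (h%:R * x)).
  by rewrite /exp_sum raddf_sum.
have -> : (fun x => normc (exp_sum H x)) =
    (fun x => Num.sqrt ((\sum_(h <- H) cos (2 * pi * (h%:R * x))) ^+ 2 +
                        (\sum_(h <- H) sin (2 * pi * (h%:R * x))) ^+ 2)).
  by apply/funext => x; rewrite -reE -imE; case: (exp_sum H x).
have lin (h : nat) : continuous (fun x : R => 2 * pi * (h%:R * x)).
  by move=> x; do 2 (apply: cvgM; first exact: cvg_cst); exact: cvg_id.
have cont (f : R -> R) : continuous f ->
    continuous (fun x => (\sum_(h <- H) f (2 * pi * (h%:R * x))) ^+ 2).
  move=> cf x; apply: (@cvg_comp _ _ _ _ (fun y => y ^+ 2));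
    last exact: exprn_continuous.
  apply: cvg_big => [|h _]; first exact: add_continuous.
  by apply: cvg_comp (lin h x) _; exact: cf.
move=> x; apply: cvg_comp; last exact: sqrt_continuous.
by apply: cvgD; apply: cont; [exact: continuous_cos|exact: continuous_sin].
Qed.

End ExpSum.

(** * Riesz products separating [b] from [b + 1/2] *)

Section RieszProduct.
Variable R : realType.
Implicit Types (b x : R).

Lemma eX x n : e x ^+ n = e (n%:R * x).
Proof.
elim: n => [|n IHn]; first by rewrite mul0r e0.
by rewrite exprS IHn -eD -natr1 mulrDl mul1r addrC.
Qed.

Lemma e_int (m : int) : e (m%:~R : R) = 1.
Proof.
by case: m => n; rewrite ?NegzE ?mulrNz ?eN e_nat// rmorph1.
Qed.

Lemma e_half_odd (m : int) : e ((m * 2 + 1)%:~R / 2 : R) = -1.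
Proof.
rewrite (_ : _ / 2 = m%:~R + 2^-1); first by rewrite eD e_int e_half mul1r.
by rewrite intrD intrM; field.
Qed.

Lemma exp_sum_fset1 (k : nat) x : exp_sum [fset k]%fset x = e (k%:R * x).
Proof. by rewrite /exp_sum big_seq_fset1. Qed.

Lemma exp_sum_fset2 (k : nat) x : (0 < k)%N ->
  exp_sum [fset 0%N; k]%fset x = 1 + e (k%:R * x).
Proof.
move=> k0; rewrite /exp_sum big_fsetU1 /=; first by rewrite big_seq_fset1 mul0r e0.
by rewrite inE; lia.
Qed.

Lemma riesz_product b (j P N L : nat) : odd j -> ~~ odd P -> (0 < P)%N ->
  e (P%:R * b) = 1 ->
  exists K : {fset nat}, [/\ K != fset0, gaps_larger N K,
    exp_sum K b = (1 + e (j%:R * b)) ^+ L &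
    exp_sum K (b + 2^-1) = (1 - e (j%:R * b)) ^+ L].
Proof.
move=> oj eP P0 ePb; elim: L => [|L [K [K0 gK Kb Kb2]]].
  by exists [fset 0%N]%fset; split; rewrite ?exp_sum_fset1 ?mul0r ?e0//;
    [apply/fset0Pn; exists 0%N; rewrite inE|exact: gaps_larger_fset1].
have [M KM] := fset_nat_bounded K.
(* adding an even multiple of the period P to j leaves e (j x) unchanged at
   b and b + 1/2 *)
pose i := (j + (M + N).+1 * P)%N.
have MNi : (M + N < i)%N by rewrite /i; nia.
have i0 : (0 < i)%N by lia.
have oi : odd i by rewrite /i oddD oddM (negbTE eP) andbF addbF.
have eib : e (i%:R * b) = e (j%:R * b).
  by rewrite natrD mulrDl eD natrM -mulrA -(eX (P%:R * b)) ePb expr1n mulr1.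
have eib2 : e (i%:R * (b + 2^-1)) = - e (j%:R * b).
  rewrite mulrDr eD eib (_ : i%:R / 2 = (i./2%:Z * 2 + 1)%:~R / 2); last first.
    by congr (_ / _); rewrite pmulrn; congr intmul; lia.
  by rewrite e_half_odd mulrN1.
(* [K] is the small block, repeated at 0 and at [i]; dilation by 1 gives the plain product with
   [1 + e (i x)]. *)
exists (dilate_add 1 [fset 0%N; i]%fset K); split.
- by apply: dilate_add_neq0 K0; apply/fset0Pn; exists i; rewrite !inE eqxx orbT.
- exact: gaps_larger_dilate_add (gaps_larger_fset2 MNi) KM gK.
- rewrite (exp_sum_dilate_add _ _ (gaps_larger_fset2 MNi) KM)// mul1r.
  by rewrite exp_sum_fset2// eib Kb exprS.
- rewrite (exp_sum_dilate_add _ _ (gaps_larger_fset2 MNi) KM)// mul1r.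
  by rewrite exp_sum_fset2// eib2 Kb2 exprS.
Qed.

(** The squares of the two moduli differ by [4 Re z]. *)
Lemma normc_1B_lt_1D (z : R[i]) : 0 < complex.Re z -> normc (1 - z) < normc (1 + z).
Proof.
case: z => c d /= c0; rewrite ltr_sqrt; last by nra.
by rewrite !add0r sqrrN ltrD2r; nra.
Qed.

Lemma exists_expr_lt (r eps : R) : 0 <= r -> r < 1 -> 0 < eps ->
  exists n, r ^+ n < eps.
Proof.
move=> r0 r1 eps0.
have : (r ^+ n @[n --> \oo] --> (0 : R))%classic by apply: cvg_expr; rewrite ger0_norm.
move=> /cvgrPdist_lt /(_ eps eps0) [n _ /(_ n (leqnn n))] /=.
by rewrite sub0r normrN ger0_norm ?exprn_ge0//; exists n.
Qed.

(** With [z = e (j b)] and [L] factors, the ratio of the two moduli is the [L]-th power of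
    [|1 - z| / |1 + z| < 1], hence small for large [L]. *)
Lemma separating_idempotent (s : nat) (m : int) (N : nat) (eps : R) :
  let b : R := (m * 2 + 1)%:~R / 2 ^+ s.+3 in 0 < eps ->
  exists K : {fset nat}, [/\ K != fset0, gaps_larger N K &
    normc (exp_sum K (b + 2^-1)) < eps * normc (exp_sum K b)].
Proof.
move=> b eps0.
have pow n : (2 ^ n)%N%:R = 2 ^+ n :> R by rewrite natrX.
have p20 n : (2 : R) ^+ n != 0 by rewrite expf_neq0// pnatr_eq0.
have eP : e ((2 ^ s.+3)%N%:R * b) = 1 by rewrite pow mulrC divfK// e_int.
have eP2 : e ((2 ^ s.+2)%N%:R * b) = -1.
  rewrite -(e_half_odd m) pow /b; congr e.
  by rewrite [2 ^+ s.+3]exprS; move: (2 ^+ s.+2) (p20 s.+2) => q q0; field.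
(* the frequency 2^(s+2) + 1 flips the sign of e b, as e (2^(s+2) b) = -1 *)
have [j [oj cj]] : exists j, odd j /\ 0 < complex.Re (e (j%:R * b)).
  have [c0|c0|c0] := ltgtP (complex.Re (e b)) 0.
  - exists (1 + 2 ^ s.+2)%N; split; first by rewrite oddD oddX.
    by rewrite natrD mulrDl mul1r eD eP2 mulrN1 /= oppr_gt0.
  - by exists 1%N; rewrite mul1r.
  (* A vanishing real part makes [e b] a fourth root of unity, against [e (2^(s+2) b) = -1]. This is
     where the denominator of [b] has to be at least 8. *)
  - have e4 : e b ^+ 4 = 1.
      move: c0 (cos2Dsin2 (2 * pi * b)); rewrite /e /= => -> s1.
      apply/eqP; rewrite !exprS expr0 eq_complex /=.
      by apply/andP; split; apply/eqP; nra.
    have := eP2; rewrite -eX !expnS mulnA exprM e4 expr1n => /eqP.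
    by rewrite -subr_eq0 opprK (pnatr_eq0 _ 2).
set z := e _ in cj.
have lt := normc_1B_lt_1D cj.
have D0 : 0 < normc (1 + z) by apply: le_lt_trans lt; exact: normc_ge0.
have [L rL] : exists L, (normc (1 - z) / normc (1 + z)) ^+ L < eps.
  apply: exists_expr_lt => //; first by rewrite divr_ge0// ?normc_ge0// ltW.
  by rewrite ltr_pdivrMr// mul1r.
have [||K [K0 gK Kb Kb2]] := riesz_product N L oj _ _ eP.
- by rewrite oddX.
- by rewrite expn_gt0.
exists K; split=> //; rewrite Kb Kb2 !normcX -ltr_pdivrMr ?exprn_gt0//.
by rewrite -expr_div_n.
Qed.

End RieszProduct.

(** * Integrals on the torus *)

Section TorusIntegral.
Variable R : realType.
Implicit Types (a b t : R) (D : set R) (g : R -> R).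
Local Notation mu := (@lebesgue_measure R).

Lemma continuous_affine a b : continuous (fun x : R => a * x + b).
Proof.
move=> x; apply: cvgD; last exact: cvg_cst.
exact: mulrl_continuous.
Qed.

Lemma measurable_affine a b : measurable_fun setT (fun x : R => a * x + b).
Proof.
by apply: continuous_measurable_fun; exact: (@continuous_affine a b).
Qed.

(** By uniqueness of Lebesgue measure: [a] times the pushforward of [mu] agrees with [mu] on
    half-open intervals. *)
Lemma lebesgue_measure_affine a b (A : set R) : 0 < a -> measurable A ->
  mu ((fun x => a * x + b) @^-1` A) = (a^-1%:E * mu A)%E.
Proof.
move=> a0 mA; pose phi := (fun x => a * x + b)
  : measurableTypeR R -> measurableTypeR R.
have mphi : measurable_fun setT phi by exact: measurable_affine.
have an : 0 <= a by exact: ltW.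
pose scaled := mscale (NngNum an) (pushforward mu phi)
  : {measure set (measurableTypeR R) -> \bar R}.
pose m := scaled mphi.
have muE : mu A = m A.
  apply: (@lebesgue_measure_unique R m) => // _ [[c d] _ <-].
  have -> : m `]c, d]%classic =
      (a%:E * mu `]((c - b) / a)%R, ((d - b) / a)%R]%classic)%E.
    rewrite /m /scaled /= /mscale /pushforward /=; congr (_ * mu _)%E.
    apply/seteqP; split=> x /=;
      rewrite !in_itv /phi /= ltr_pdivrMr// ler_pdivlMr// => /andP[h1 h2];
      apply/andP; split; lra.
  rewrite !lebesgue_measure_itv /= !lte_fin ltr_pM2r ?invr_gt0// ltrD2r.
  case: ifP => _; last by rewrite mule0.
  by rewrite -!EFinD -EFinM; congr EFin; field; rewrite gt_eqF.
by rewrite muE /m /scaled /= /mscale /= muleA -EFinM mulVf ?gt_eqF// mul1e.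
Qed.

Lemma measurable_preimage_affine a b (A : set R) :
  measurable A -> measurable ((fun x => a * x + b) @^-1` A).
Proof. by move=> mA; rewrite -[X in measurable X]setTI; exact: measurable_affine. Qed.

(** Change of variables, the pushforward of [mu] under the affine map being [a^-1] times [mu]. *)
Lemma integral_affine a b (A : set R) g : 0 < a -> measurable A ->
  measurable_fun setT g -> (forall x, 0 <= g x) ->
  (\int[mu]_(x in (fun x => (a * x + b)%R) @^-1` A) (g (a * x + b)%R)%:E =
   a^-1%:E * \int[mu]_(x in A) (g x)%:E)%E.
Proof.
move=> a0 mA mg g0.
have mEg : measurable_fun A (EFin \o g).
  by apply/measurable_EFinP; exact: measurable_funS mg.
have mphi : measurable_fun setT
    ((fun x => a * x + b) : measurableTypeR R -> measurableTypeR R).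
  exact: measurable_affine.
rewrite -(@ge0_integral_pushforward _ _ (measurableTypeR R) (measurableTypeR R)
  R _ mphi mu A (EFin \o g))//=;
  last by move=> *; rewrite lee_fin.
have an : 0 <= a^-1 by rewrite invr_ge0 ltW.
rewrite -(@ge0_integral_mscale _ _ _ mu A mA (NngNum an) (EFin \o g))//=;
  last by move=> *; rewrite lee_fin.
apply: eq_measure_integral => //= B mB BA.
exact: lebesgue_measure_affine.
Qed.

Definition periodic1 g := forall x, g (x + 1) = g x.

Definition torus_int g D := (\int[mu]_(x in D `&` `[0%R, 1%R[) (g x)%:E)%E.

(** * Translation and doubling in integrals of periodic functions *)

Section Periodic.
Variables (g : R -> R) (D : set R).
Hypotheses (mg : measurable_fun setT g) (g_ge0 : forall x, 0 <= g x).
Hypotheses (mD : measurable D) (pg : periodic1 g) (tD : torus_set D).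

Let measD (I : set R) : measurable I -> measurable (D `&` I).
Proof. exact: measurableI. Qed.

Let split_integral (x y z : R) : x <= y -> y <= z ->
  (\int[mu]_(t in D `&` `[x, z[) (g t)%:E =
   \int[mu]_(t in D `&` `[x, y[) (g t)%:E +
   \int[mu]_(t in D `&` `[y, z[) (g t)%:E)%E.
Proof.
move=> xy yz; rewrite -ge0_integral_setU//.
- rewrite -setIUr; congr integral; congr (_ `&` _).
  apply/seteqP; split=> t /=; rewrite !in_itv /=.
    by case: (ltP t y) => ty /andP[h1 h2]; [left|right]; rewrite ?h1 ?h2 ?ty.
  by case=> /andP[h1 h2]; apply/andP; split; lra.
- exact: measD.
- exact: measD.
- by apply/measurable_EFinP; exact: measurable_funS mg.
- by move=> *; rewrite lee_fin.
- rewrite disj_set2E; apply/eqP; rewrite -subset0 => t [[_ +] [_]] /=.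
  rewrite !in_itv /= => /andP[_ h1] /andP[h2 _].
  by have := lt_le_trans h1 h2; rewrite ltxx.
Qed.

(** Cut the window at 1; periodicity moves the piece over [[1, t + 1[] back to [[0, t[]. *)
Lemma torus_int_window t : 0 <= t <= 1 ->
  (\int[mu]_(x in D `&` `[t, (t + 1)%R[) (g x)%:E = torus_int g D)%E.
Proof.
move=> /andP[t0 t1].
have t2 : 1 <= t + 1 by lra.
rewrite (@split_integral t 1 (t + 1))//.
rewrite /torus_int (@split_integral 0 t 1)// addeC; congr (_ + _)%E.
have := @integral_affine 1 1 (D `&` `[1, t + 1[) g ltr01
  (measD (measurable_itv _)) mg g_ge0.
rewrite invr1 mul1e => <-.
rewrite (_ : _ @^-1` _ = D `&` `[0, t[).
  by apply: eq_integral => x _; rewrite mul1r pg.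
apply/seteqP; split=> x /=; rewrite !in_itv mul1r /= => -[/tD dx /andP[h1 h2]];
  split=> //; apply/andP; split; lra.
Qed.

Lemma torus_int_half_shift :
  torus_int (fun x => g (x + 2^-1)) [set x | D (x + 2^-1)] = torus_int g D.
Proof.
rewrite -(@torus_int_window 2^-1); last by apply/andP; split; lra.
have := @integral_affine 1 2^-1 (D `&` `[2^-1, 2^-1 + 1[) g ltr01
  (measD (measurable_itv _)) mg g_ge0.
rewrite invr1 mul1e => <-.
rewrite /torus_int (_ : _ @^-1` _ = [set x | D (x + 2^-1)] `&` `[0, 1[).
  by apply: eq_integral => x _; rewrite mul1r.
apply/seteqP; split=> x /=; rewrite !in_itv mul1r /= => -[dx /andP[h1 h2]];
  split=> //; apply/andP; split; lra.
Qed.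

(** Doubling maps [[0, 1[] onto [[0, 2[], which is two periods; the Jacobian factor 1/2
    compensates. *)
Lemma torus_int_double :
  torus_int (fun x => g (2 * x)) [set x | D (2 * x)] = torus_int g D.
Proof.
have := @integral_affine 2 0 (D `&` `[0, 2[) g (ltr0n _ 2)
  (measD (measurable_itv _)) mg g_ge0.
rewrite (@split_integral 0 1 2) ?ler01 ?ler1n//.
rewrite (@torus_int_window 1) ?lexx ?ler01// -/(torus_int g D).
rewrite -mule2n -mule_natl muleA -EFinM mulVf// mul1e => <-.
rewrite /torus_int (_ : _ @^-1` _ = [set x | D (2 * x)] `&` `[0, 1[).
  by apply: eq_integral => x _; rewrite addr0.
apply/seteqP; split=> x /=; rewrite !in_itv addr0 /= => -[dx /andP[h1 h2]];
  split=> //; apply/andP; split; lra.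
Qed.

End Periodic.

End TorusIntegral.

(** * Real-valued integrals on the torus *)

Section TorusInt.
Variable R : realType.
Implicit Types (D A B : set R) (g h : R -> R).
Local Notation mu := (@lebesgue_measure R).

(** Boundedness makes integrals over the torus finite, so that they can be handled as real
    numbers. *)
Definition bounded_ge0 g :=
  [/\ measurable_fun setT g, forall x, 0 <= g x & exists M, forall x, g x <= M].

Lemma torus_int_fin g D : bounded_ge0 g -> measurable D ->
  torus_int g D = (fine (torus_int g D))%:E.
Proof.
move=> [mg g0 [M gM]] mD; rewrite fineK// ge0_fin_numE; last first.
  by apply: integral_ge0 => x _; rewrite lee_fin.
have mDI : measurable (D `&` `[0, 1[) by exact: measurableI.
apply: (@le_lt_trans _ _ (\int[mu]_(x in D `&` `[0%R, 1%R[) (cst M%:E) x)%E).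
  apply: ge0_le_integral => //.
  - by move=> x _; rewrite lee_fin.
  - by apply/measurable_EFinP; exact: measurable_funS mg.
  - by move=> x _; rewrite lee_fin.
rewrite integral_cst//.
have m1 : (mu (D `&` `[0%R, 1%R[) <= 1)%E.
  have <- : mu `[0, 1[%classic = 1%E.
    by rewrite lebesgue_measure_itv/= lte_fin ltr01 sube0.
  by apply: le_measure; rewrite ?inE//; exact: subIsetr.
apply: (@le_lt_trans _ _ (M%:E * 1)%E); last by rewrite mule1 ltry.
by apply: lee_pmul => //; rewrite lee_fin (le_trans (g0 0) (gM 0)).
Qed.

Definition rtorus_int g D := fine (torus_int g D).

Lemma rtorus_int_ge0 g D : (forall x, 0 <= g x) -> 0 <= rtorus_int g D.
Proof. by move=> g0; apply: fine_ge0; apply: integral_ge0 => x _; rewrite lee_fin. Qed.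

Lemma rtorus_int_subset g A B : bounded_ge0 g -> measurable A -> measurable B ->
  A `<=` B -> rtorus_int g A <= rtorus_int g B.
Proof.
move=> bg mA mB AB; rewrite -lee_fin -!torus_int_fin//.
have [mg g0 _] := bg.
apply: ge0_subset_integral; try exact: measurableI.
- by apply/measurable_EFinP; exact: measurable_funS mg.
- by move=> x _; rewrite lee_fin.
- exact: setSI.
Qed.

Lemma rtorus_int_setU g A B : bounded_ge0 g -> measurable A -> measurable B ->
  [disjoint A & B] -> rtorus_int g (A `|` B) = rtorus_int g A + rtorus_int g B.
Proof.
move=> bg mA mB AB; apply: EFin_inj; rewrite EFinD -!torus_int_fin//;
  last exact: measurableU.
have [mg g0 _] := bg.
rewrite /torus_int setIUl; apply: ge0_integral_setU; try exact: measurableI.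
- by apply/measurable_EFinP; exact: measurable_funS mg.
- by move=> x _; rewrite lee_fin.
- move: AB; rewrite !disj_set2E => /eqP AB; apply/eqP.
  by rewrite setIACA AB set0I.
Qed.

Lemma rtorus_int_setC g A : bounded_ge0 g -> measurable A ->
  rtorus_int g setT = rtorus_int g A + rtorus_int g (~` A).
Proof.
move=> bg mA; rewrite -rtorus_int_setU ?setUv//; first exact: measurableC.
by rewrite disj_set2E setICr.
Qed.

Lemma rtorus_int_setU_le g A B : bounded_ge0 g -> measurable A -> measurable B ->
  rtorus_int g (A `|` B) <= rtorus_int g A + rtorus_int g B.
Proof.
move=> bg mA mB; rewrite -(setDUK (@subsetUl _ A B)) rtorus_int_setU//.
- rewrite lerD2l; apply: rtorus_int_subset => //; last by move=> x [[]].
  by apply: measurableD => //; exact: measurableU.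
- by apply: measurableD => //; exact: measurableU.
- by rewrite disj_set2E setDIK.
Qed.

Lemma rtorus_int_le (k : R) g h D : 0 <= k -> bounded_ge0 g -> bounded_ge0 h ->
  measurable D -> (forall x, D x -> g x <= k * h x) ->
  rtorus_int g D <= k * rtorus_int h D.
Proof.
move=> k0 bg bh mD gh; rewrite -lee_fin EFinM -!torus_int_fin//.
have [mg g0 _] := bg; have [mh h0 _] := bh.
have mDI : measurable (D `&` `[0, 1[) by exact: measurableI.
have mEh : measurable_fun (D `&` `[0%R, 1%R[) (EFin \o h).
  by apply/measurable_EFinP; exact: measurable_funS mh.
rewrite /torus_int -ge0_integralZl//; last by move=> x _; rewrite lee_fin.
apply: ge0_le_integral => //.
- by move=> x _; rewrite lee_fin.
- by apply/measurable_EFinP; exact: measurable_funS mg.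
- exact: emeasurable_funM.
- by move=> x [Dx _]; rewrite -EFinM lee_fin gh.
Qed.

Lemma bounded_ge0M g h : bounded_ge0 g -> bounded_ge0 h ->
  bounded_ge0 (fun x => g x * h x).
Proof.
move=> [mg g0 [M gM]] [mh h0 [L hL]]; split.
- exact: measurable_funM.
- by move=> x; rewrite mulr_ge0.
- by exists (M * L) => x; rewrite ler_pM.
Qed.

Lemma bounded_ge0_affine a b g : bounded_ge0 g -> bounded_ge0 (fun x => g (a * x + b)).
Proof.
move=> [mg g0 [M gM]]; split=> //; last by exists M.
exact: (measurableT_comp mg (measurable_affine a b)).
Qed.

End TorusInt.

(** * Transfer of concentration through doubling and a multiplier *)

Section Transfer.
Variable R : realType.
Variables (g r : R -> R) (U E W : set R) (A B M : R).
Hypotheses (bg : bounded_ge0 g) (br : bounded_ge0 r).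
Hypotheses (pg : periodic1 g) (pr : periodic1 r).
Hypotheses (mU : measurable U) (mE : measurable E) (mW : measurable W).
Hypotheses (tU : torus_set U) (tW : torus_set W).
Hypotheses (UE : U `<=` E) (WU : forall x, W (2 * x) <-> U x \/ U (x + 2^-1)).
Hypotheses (rA : forall x, U x -> A <= r x) (rB : forall x, U x -> r (x + 2^-1) <= B).
Hypotheses (rM : forall x, r x <= M) (A_gt0 : 0 < A) (B_ge0 : 0 <= B).

(** Let [X] be the mass of [g (2 x) r (x)] on [U]. The two numerical hypotheses bound the mass on
    the half-shift of [U], where [r <= B], and the mass outside both sets, where little of [g (2 x)]
    lives, by [(1 - c) / 2 * X] each. *)
Lemma transfer_concentration (c c' : R) : 0 <= c -> c < 1 -> 0 < c' -> c' <= 1 ->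
  B <= (1 - c) / 2 * A -> 2 * M * (1 - c') <= (1 - c) / 2 * (c' * A) ->
  c' * rtorus_int g setT <= rtorus_int g W ->
  c * rtorus_int (fun x => g (2 * x) * r x) setT <=
    rtorus_int (fun x => g (2 * x) * r x) E.
Proof.
move=> c0 c1 c'0 c'1 hB hM hg.
have [mg g0 _] := bg; have [mr r0 _] := br.
pose h x := g (2 * x).
have bh : bounded_ge0 h.
  rewrite (_ : h = fun x => g (2 * x + 0)); first exact: bounded_ge0_affine.
  by apply/funext => x; rewrite addr0.
have bhr : bounded_ge0 (fun x => h x * r x) by exact: bounded_ge0M.
have [mh h0 _] := bh; have [_ hr0 _] := bhr.
pose V := [set x | U (x + 2^-1)].
have mV : measurable V.
  have := measurable_preimage_affine 1 2^-1 mU.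
  by congr measurable; apply/funext => x /=; rewrite mul1r.
(* As [h] has period 1/2, it puts equal mass on [U] and [V]. *)
have h_half x : h (x + 2^-1) = h x by rewrite /h mulrDr divff// pg.
have ph : periodic1 h by move=> x; rewrite (_ : x + 1 = x + 2^-1 + 2^-1) ?h_half//; lra.
have WE : [set x | W (2 * x)] = U `|` V by apply/funext => x; apply/propext; exact: WU.
have hT : rtorus_int h setT = rtorus_int g setT.
  by rewrite /rtorus_int -(torus_int_double mg g0 measurableT pg)//.
have hW : rtorus_int h (U `|` V) = rtorus_int g W.
  by rewrite /rtorus_int -(torus_int_double mg g0 mW pg tW) WE.
have hV : rtorus_int h V = rtorus_int h U.
  rewrite /rtorus_int -(torus_int_half_shift mh h0 mU ph tU).
  by congr (fine (torus_int _ _)); apply/funext => x; rewrite h_half.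
have mUV : measurable (U `|` V) by exact: measurableU.
have leU : rtorus_int h (U `|` V) <= 2 * rtorus_int h U.
  by apply: le_trans (rtorus_int_setU_le bh mU mV) _; rewrite hV; lra.
have hC := rtorus_int_setC bh mUV.
have hrC := rtorus_int_setC bhr mUV.
have hrUV := rtorus_int_setU_le bhr mU mV.
have M0 : 0 <= M := le_trans (r0 0) (rM 0).
have hrV : rtorus_int (fun x => h x * r x) V <= B * rtorus_int h U.
  rewrite -hV; apply: rtorus_int_le => // x Vx; rewrite mulrC ler_wpM2r//.
  by have := rB Vx; rewrite (_ : x + 2^-1 + 2^-1 = x + 1) ?pr//; lra.
have hrZ : rtorus_int (fun x => h x * r x) (~` (U `|` V)) <=
    M * rtorus_int h (~` (U `|` V)).
  apply: rtorus_int_le => //; first exact: measurableC.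
  by move=> x _; rewrite mulrC ler_wpM2r.
have hrU : A * rtorus_int h U <= rtorus_int (fun x => h x * r x) U.
  rewrite -ler_pdivlMl//; apply: rtorus_int_le => //; first by rewrite invr_ge0 ltW.
  by move=> x Ux; rewrite ler_pdivlMl// mulrC ler_wpM2l// rA.
have hrE := rtorus_int_subset bhr mU mE UE.
have G0 := rtorus_int_ge0 U h0; have I0 := rtorus_int_ge0 setT h0.
move: hT hW leU hC hrC hrUV hrV hrZ hrU hrE G0 I0 hg.
rewrite -/h.
set I := rtorus_int h setT; set G := rtorus_int h U.
set X := rtorus_int (fun x => h x * r x) U.
move: (rtorus_int h (U `|` V)) (rtorus_int h (~` (U `|` V))) => hUV hZ.
move: (rtorus_int _ (~` (U `|` V))) (rtorus_int _ (U `|` V)) (rtorus_int _ V) => Z UV Vv.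
move: (rtorus_int _ setT) (rtorus_int _ E) (rtorus_int g W) (rtorus_int g setT).
move=> T X' gW gT <- <- leU hC hrC hrUV hrV hrZ hrU hrE G0 I0 hg.
have c1' : 0 <= 1 - c by lra.
(* Outside [U] and [V] the mass of [h] is at most [(1 - c') * I]; the bounds [c' * I <= 2 * G] and
   [A * G <= X] turn this into a multiple of [X]. *)
have Zle : Z <= (1 - c) / 2 * X.
  have ZI : hZ <= (1 - c') * I by lra.
  apply: le_trans hrZ (le_trans (ler_wpM2l M0 ZI) _).
  have h1 := ler_wpM2r I0 hM.
  have h2 : (1 - c) / 2 * A * (c' * I) <= (1 - c) / 2 * A * (2 * G).
    by rewrite ler_wpM2l ?mulr_ge0 ?divr_ge0 ?(ltW A_gt0)//; lra.
  have h3 : (1 - c) / 2 * (A * G) <= (1 - c) / 2 * X by rewrite ler_wpM2l ?divr_ge0.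
  lra.
have BX : B * G <= (1 - c) / 2 * X.
  apply: le_trans (_ : (1 - c) / 2 * A * G <= _); first exact: ler_wpM2r.
  by rewrite -mulrA ler_wpM2l// divr_ge0// subr_ge0 ltW.
have X0 : 0 <= X by apply: le_trans hrU; rewrite mulr_ge0// ltW.
have TX : T <= (2 - c) * X by lra.
apply: le_trans hrE; apply: le_trans (ler_wpM2l c0 TX) _.
(* The total is at most [(2 - c) * X], and [c * (2 - c) = 1 - (1 - c)^2 <= 1]. *)
rewrite -subr_ge0 (_ : _ - _ = (1 - c) ^+ 2 * X); last by ring.
by rewrite mulr_ge0// sqr_ge0.
Qed.

End Transfer.

(** * Concentration *)

Section Concentration.
Variables (R : realType) (p : R).
Hypothesis p_gt0 : 0 < p.
Implicit Types (H K : {fset nat}) (E U W : set R) (b c x : R).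
Definition pow_norm H x := normc (exp_sum H x) `^ p.
Local Notation w := pow_norm.

Lemma torus_set_int E (m : int) x : torus_set E -> E (x + m%:~R) <-> E x.
Proof.
move=> tE; have tEn (n : nat) y : E (y + n%:R) <-> E y.
  elim: n y => [|n IHn] y; first by rewrite addr0.
  by rewrite -natr1 addrA tE.
case: m => n; first exact: tEn.
by rewrite NegzE mulrNz -(tEn n.+1 (x - _)) subrK.
Qed.

Lemma bounded_ge0_pow_norm H : bounded_ge0 (w H).
Proof.
split.
- have mN : measurable_fun setT (fun x => normc (exp_sum H x)).
    by apply: continuous_measurable_fun; exact: continuous_normc_exp_sum.
  exact: (measurableT_comp (measurable_powR p) mN).
- by move=> x; exact: powR_ge0.
- exists ((size H)%:R `^ p) => x.
  by rewrite ge0_ler_powR ?nnegrE ?ler0n ?normc_ge0 ?normc_exp_sum_le// ltW.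
Qed.

Lemma periodic1_pow_norm H : periodic1 (w H).
Proof. by move=> x; rewrite /pow_norm exp_sumD1. Qed.

Lemma concentratedE c E H : measurable E ->
  concentrated p c E (exp_sum H) <-> c * rtorus_int (w H) setT <= rtorus_int (w H) E.
Proof.
move=> mE; rewrite /concentrated /torus_integral -/(torus_int (w H) E).
rewrite -/(torus_int (w H) setT) (torus_int_fin (bounded_ge0_pow_norm H) mE).
rewrite (torus_int_fin (bounded_ge0_pow_norm H) measurableT).
by rewrite -EFinM lee_fin.
Qed.

(** The hypothesis at 1/2 moved to any point [b], stated with frequency sets and real integrals.
    Taking [0 <= c] allows inequalities to be multiplied by [c]. *)
Definition concentrates_at b := forall c E N, 0 <= c -> c < 1 ->
  symmetric_open E -> E b -> exists H, [/\ H != fset0, gaps_larger N H &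
    c * rtorus_int (w H) setT <= rtorus_int (w H) E].

Lemma open_affine a b (A : set R) : open A -> open [set x | A (a * x + b)].
Proof. by have /continuousP := @continuous_affine R a b; apply. Qed.

(** * Passing from [2 b] to [b] *)

Section Halving.
Variable U : set R.
Hypothesis sU : symmetric_open U.
Hypothesis sU2 : forall x, U (x + 2^-1) -> U (- x + 2^-1).

(** Image of [U] under doubling on the torus: modulo 1, the halves of [y] are [y / 2] and
    [y / 2 + 1/2]. *)
Let W : set R := [set y | U (2^-1 * y) \/ U (2^-1 * y + 2^-1)].

Lemma symmetric_open_doubled : symmetric_open W.
Proof.
have [tU oU symU] := sU; split.
- move=> y; rewrite /W /= mulrDr mulr1 -addrA (_ : 2^-1 + 2^-1 = 1); last by lra.
  by rewrite tU; tauto.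
- apply: openU; last exact: open_affine.
  have := @open_affine 2^-1 0 _ oU.
  by congr open; apply/funext => y /=; rewrite addr0.
- move=> y; rewrite /W /= mulrN => -[/symU|/sU2]; by [left|right].
Qed.

Lemma doubled_preimage x : W (2 * x) <-> U x \/ U (x + 2^-1).
Proof. by rewrite /W /= mulrA mulVf// mul1r. Qed.

End Halving.

Lemma pow_norm_dilate_add M N H K x : gaps_larger (M + N) H ->
  (forall k, k \in K -> (k <= M)%N) ->
  w (dilate_add 2 H K) x = w H (2 * x) * w K x.
Proof.
move=> gH KM; rewrite /pow_norm (exp_sum_dilate_add _ _ gH KM)//.
by rewrite normcM powRM ?normc_ge0.
Qed.

(** Here [b + 1/2] equals [-b] modulo 1, so it lies in [E] too. Shrinking [E] to a set [U] of period
    1/2 makes [U] the whole preimage of [W], and [f (2 x)] works without a multiplier. *)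
Lemma concentrates_at_odd_quarter b : concentrates_at (2 * b) ->
  (exists m : int, b + 2^-1 = - b + m%:~R) -> concentrates_at b.
Proof.
move=> conc [m bm] c E N c0 c1 sE Eb; have [tE oE symE] := sE.
pose U := E `&` [set x | E (x + 2^-1)].
have EN x : E (x + 2^-1) -> E (- x + 2^-1).
  by move=> /symE /tE; rewrite opprD -addrA (_ : - 2^-1 + 1 = 2^-1)//; lra.
have tU : torus_set U by move=> x; rewrite /U /= addrAC !tE.
have oU : open U.
  apply: openI => //; have := @open_affine 1 2^-1 _ oE.
  by congr open; apply/funext => x /=; rewrite mul1r.
have sU : symmetric_open U by split=> // x [/symE ? /EN].
have U2 x : U (x + 2^-1) <-> U x.
  rewrite /U /= -addrA (_ : 2^-1 + 2^-1 = 1); last by lra.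
  by rewrite tE; tauto.
have sU2 x : U (x + 2^-1) -> U (- x + 2^-1).
  by rewrite !U2; have [_ _] := sU; apply.
have [|H [H0 gH cH]] := conc c _ N c0 c1 (symmetric_open_doubled sU sU2).
  apply/doubled_preimage; left; split=> //=.
  by rewrite bm; apply/(torus_set_int m (- b) tE)/symE.
(* The frequency set [{0}] gives the constant 1, so this is [f (2 x)]. *)
exists (dilate_add 2 H [fset 0%N]%fset); split.
- by apply: dilate_add_neq0 => //; apply/fset0Pn; exists 0%N; rewrite inE.
- apply: (@gaps_larger_dilate_add _ 0) => //; last exact: gaps_larger_fset1.
  by move=> k /fset1P ->.
have -> : w (dilate_add 2 H [fset 0%N]%fset) = fun x => w H (2 * x).
  apply/funext => x; rewrite (@pow_norm_dilate_add 0 N)//; last by move=> k /fset1P ->.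
  by rewrite [w [fset 0%N]%fset x]/pow_norm exp_sum_fset1 mul0r e0 normc1 powR1 mulr1.
have [mH wH0 _] := bounded_ge0_pow_norm H.
set W := [set y | _] in cH.
have tW : torus_set W by have [] := symmetric_open_doubled sU sU2.
have mW : measurable W.
  by apply: open_measurable; have [] := symmetric_open_doubled sU sU2.
have bH2 : bounded_ge0 (fun x => w H (2 * x)).
  have := bounded_ge0_affine 2 0 (bounded_ge0_pow_norm H).
  by congr bounded_ge0; apply/funext => x; rewrite addr0.
have WU : [set x | W (2 * x)] = U.
  apply/funext => x; apply/propext.
  by apply: iff_trans (doubled_preimage U x) _; rewrite U2; tauto.
rewrite /rtorus_int -(torus_int_double mH wH0 measurableT (periodic1_pow_norm H))// in cH.
rewrite -(torus_int_double mH wH0 mW (periodic1_pow_norm H) tW) WU in cH.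
apply: le_trans cH _; apply: rtorus_int_subset => //.
- exact: open_measurable.
- exact: open_measurable.
- by move=> x [].
Qed.

(** * Halving with a separating multiplier *)

Lemma open_exp_sum_gt K (a : R) : open [set x | a < normc (exp_sum K x)].
Proof.
have /continuousP cK := @continuous_normc_exp_sum R K.
exact: (cK _ (@open_gt R a)).
Qed.

Lemma open_exp_sum_lt K (a : R) : open [set x | normc (exp_sum K x) < a].
Proof.
have /continuousP cK := @continuous_normc_exp_sum R K.
exact: (cK _ (@open_lt R a)).
Qed.

Lemma normc_exp_sumN K x : normc (exp_sum K (- x)) = normc (exp_sum K x).
Proof. by rewrite exp_sumN normc_conj. Qed.

Lemma normc_exp_sumN_half K x :
  normc (exp_sum K (- x + 2^-1)) = normc (exp_sum K (x + 2^-1)).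
Proof.
rewrite -normc_exp_sumN -(exp_sumD1 _ (- _)); congr (normc (exp_sum _ _)); lra.
Qed.

(** Fix the multiplier [K] first, shrink [E] to the open set [U] where its separation persists, and
    only then choose [H], with gaps and concentration adapted to [K]. *)
Lemma concentrates_at_halve b : concentrates_at (2 * b) ->
  (forall N (eps : R), 0 < eps -> exists K, [/\ K != fset0, gaps_larger N K &
    normc (exp_sum K (b + 2^-1)) < eps * normc (exp_sum K b)]) ->
  concentrates_at b.
Proof.
move=> conc sep c E N c0 c1 sE Eb; have [tE oE symE] := sE.
have eta0 : 0 < (1 - c) / 2 by lra.
(* Chosen so that its [p]-th power is the ratio [(1 - c) / 2] allowed between [B] and [A]. *)
pose dl := ((1 - c) / 2) `^ p^-1.
have dl0 : 0 < dl by exact: powR_gt0.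
have [K [K0 gK Kb]] := sep N dl dl0.
pose X := normc (exp_sum K b); pose Y := normc (exp_sum K (b + 2^-1)).
have YX : Y / dl < X by rewrite ltr_pdivrMr// mulrC.
have Y0 : 0 <= Y / dl by rewrite divr_ge0 ?normc_ge0// ltW.
(* The midpoint leaves strict room on both sides, so both inequalities defining [U] hold at [b]. *)
pose al := (X + Y / dl) / 2.
have alX : al < X by rewrite /al; lra.
have Yal : Y < dl * al by rewrite -ltr_pdivrMl// mulrC /al; lra.
have al0 : 0 < al by rewrite /al; lra.
pose U := E `&` ([set x | al < normc (exp_sum K x)] `&`
                 [set x | normc (exp_sum K (x + 2^-1)) < dl * al]).
have tU : torus_set U by move=> x; rewrite /U /= addrAC !exp_sumD1 tE.
have oU : open U.
  apply: openI => //; apply: openI; first exact: open_exp_sum_gt.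
  have := @open_affine 1 2^-1 _ (@open_exp_sum_lt K (dl * al)).
  by congr open; apply/funext => x /=; rewrite mul1r.
have sU : symmetric_open U.
  split=> // x [/symE ? [/= h1 h2]]; split=> //; split=> /=.
    by rewrite normc_exp_sumN.
  by rewrite normc_exp_sumN_half.
have sU2 x : U (x + 2^-1) -> U (- x + 2^-1).
  have [_ _ symU] := sU.
  by move=> /symU /tU; rewrite opprD -addrA (_ : - 2^-1 + 1 = 2^-1)//; lra.
have [M KM] := fset_nat_bounded K.
(* Upper bound of the multiplier; the successor makes positivity immediate. *)
pose L := ((size K).+1%:R : R) `^ p.
have L0 : 0 < L by rewrite powR_gt0.
pose A := al `^ p.
have A0 : 0 < A by rewrite powR_gt0.
(* The solution of [2 * L * (1 - c') = (1 - c) / 2 * (c' * A)], the equality case of the transfer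
   condition. *)
pose c' := 4 * L / (4 * L + (1 - c) * A).
have den0 : 0 < 4 * L + (1 - c) * A by rewrite addr_gt0 ?mulr_gt0//; lra.
have c'0 : 0 < c' by rewrite divr_gt0// mulr_gt0.
have c'1 : c' < 1 by rewrite ltr_pdivrMr// mul1r ltrDl mulr_gt0//; lra.
have [|H [H0 gH cH]] := conc c' _ (M + N)%N (ltW c'0) c'1
    (symmetric_open_doubled sU sU2).
  apply/doubled_preimage; left; split=> //; split.
exists (dilate_add 2 H K); split.
- exact: dilate_add_neq0.
- exact: gaps_larger_dilate_add gH KM gK.
have -> : w (dilate_add 2 H K) = fun x => w H (2 * x) * w K x.
  by apply/funext => x; rewrite (pow_norm_dilate_add _ gH KM).
set W := [set y | _] in cH.
have tW : torus_set W by have [] := symmetric_open_doubled sU sU2.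
have mW : measurable W.
  by apply: open_measurable; have [] := symmetric_open_doubled sU sU2.
apply: (@transfer_concentration _ (w H) (w K) U E W A ((dl * al) `^ p) L
  (bounded_ge0_pow_norm H) (bounded_ge0_pow_norm K) (periodic1_pow_norm H) (periodic1_pow_norm K)
  _ _ mW tU tW _ _ _ _ _ A0 _ c c') => //.
- exact: open_measurable.
- exact: open_measurable.
- exact: subIsetl.
- exact: doubled_preimage.
- by move=> x [_ [/ltW h _]]; apply: ge0_ler_powR h; rewrite ?nnegrE ?normc_ge0 ?ltW.
- move=> x [_ [_ /ltW h]]; apply: ge0_ler_powR h; rewrite ?nnegrE ?normc_ge0 ?ltW//.
  exact: mulr_gt0.
- move=> x; apply: ge0_ler_powR; rewrite ?nnegrE ?normc_ge0 ?ler0n ?(ltW p_gt0)//.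
  by rewrite (le_trans (normc_exp_sum_le K x))// ler_nat.
- exact: powR_ge0.
- exact: ltW.
- by rewrite powRM ?(ltW dl0) ?(ltW al0)// -powRrM mulVf ?gt_eqF// powRr1 ?(ltW eta0).
- by rewrite le_eqVlt; apply/orP; left; apply/eqP; rewrite /c'; field; rewrite gt_eqF.
Qed.

(** Three cases by denominator: 2 reduces to 1/2 modulo 1, 4 needs no multiplier, and from 8 on a
    Riesz product separates [b] from [b + 1/2]. *)
Lemma concentrates_at_dyadic (n : nat) (m : int) : concentrates_at 2^-1 ->
  concentrates_at ((m * 2 + 1)%:~R / 2 ^+ n.+1).
Proof.
move=> half; elim: n m => [|n IHn] m.
  move=> c E N c0 c1 sE Eb; apply: half => //.
  have [tE _ _] := sE; apply/(torus_set_int m _ tE).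
  by move: Eb; congr E; rewrite intrD intrM; field.
have dbl : 2 * ((m * 2 + 1)%:~R / 2 ^+ n.+2) = (m * 2 + 1)%:~R / 2 ^+ n.+1 :> R.
  have : (2 : R) ^+ n.+1 != 0 by rewrite expf_neq0.
  by rewrite [2 ^+ n.+2]exprS; move: (2 ^+ n.+1) => q q0; field.
case: n => [|n] in IHn dbl *.
  apply: concentrates_at_odd_quarter; first by rewrite dbl.
  by exists (m + 1); rewrite !intrD intrM; field.
apply: concentrates_at_halve; first by rewrite dbl.
by move=> N eps; exact: separating_idempotent.
Qed.

(** * Density of the dyadic points and value of the constant *)

Lemma open_dyadic E : open E -> E !=set0 ->
  exists n (m : int), E ((m * 2 + 1)%:~R / 2 ^+ n.+1).
Proof.
move=> oE [x Ex]; have /nbhs_ballP[r /= r0 rE] := open_nbhs_nbhs (conj oE Ex).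
have [n nr] := @exists_expr_lt R 2^-1 r ltac:(by rewrite invr_ge0) ltac:(lra) r0.
(* The point is the midpoint of the dyadic interval of length [2^-n] containing [x]. *)
exists n, (Num.floor (2 ^+ n * x)); apply: rE; rewrite /ball /=.
have q0 : 0 < (2 : R) ^+ n by rewrite exprn_gt0.
have /andP[f1 f2] := real_floor_itv (num_real (2 ^+ n * x)).
apply: le_lt_trans nr; rewrite exprVn.
move: f1 f2; move: (Num.floor _) => k; rewrite !intrD intrM exprS.
move: (2 ^+ n) q0 => q q0 f1 f2.
have -> : x - (k%:~R * 2%:~R + 1%:~R) / (2 * q) = (q * x - k%:~R - 2^-1) / q.
  by field; rewrite gt_eqF.
rewrite normrM normfV (gtr0_norm q0) ler_piMl ?invr_ge0 ?(ltW q0)//.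
by rewrite ler_norml; apply/andP; split; lra.
Qed.

(** At 0 the sum equals the size of [H], at least 1, so by continuity its modulus exceeds 1/2 on
    some [[0, d[]. *)
Lemma rtorus_int_pow_norm_gt0 H : H != fset0 -> 0 < rtorus_int (w H) setT.
Proof.
move=> /fset0Pn[h hH].
have sH : 1 <= (size H)%:R :> R.
  by rewrite ler1n; have : h \in enum_fset H := hH; case: (enum_fset H).
have n0 : normc (exp_sum H (0 : R)) = (size H)%:R.
  have -> : exp_sum H (0 : R) = ((size H)%:R : R)%:C by rewrite exp_sum0 rmorph_nat.
  by rewrite /= expr0n addr0 sqrtr_sqr ger0_norm.
have /nbhs_ballP[r /= r0 rH] : nbhs (0 : R) [set x | 2^-1 < normc (exp_sum H x)].
  apply: open_nbhs_nbhs; split; first exact: open_exp_sum_gt.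
  by rewrite /= n0; lra.
(* The cap at 1 keeps [[0, d[] inside the fundamental domain. *)
pose d := Num.min r 1.
have d0 : 0 < d by rewrite lt_min r0 ltr01.
pose D := `[0, d[%classic : set R.
have mD : measurable D by exact: measurable_itv.
have b1 : bounded_ge0 (cst 1 : R -> R) by split=> //; exists 1.
have k0 : 0 < 2^-1 `^ p :> R by rewrite powR_gt0.
have le1 : rtorus_int (cst 1) D <= (2^-1 `^ p)^-1 * rtorus_int (w H) D.
  apply: rtorus_int_le => //; [exact: bounded_ge0_pow_norm|].
  move=> x; rewrite /D /= in_itv /= lt_min => /and3P[x0 xr _].
  rewrite -ler_pdivrMl ?invr_gt0// invrK mulr1.
  apply: ge0_ler_powR; rewrite ?nnegrE ?normc_ge0 ?invr_ge0 ?(ltW p_gt0)//.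
  by apply/ltW/rH; rewrite /ball /= sub0r normrN ger0_norm.
have D1 : rtorus_int (cst 1) D = d.
  rewrite /rtorus_int /torus_int setIidl; last first.
    by move=> x; rewrite /D /= !in_itv /= lt_min => /and3P[-> _ ->].
  transitivity (fine (1 * @lebesgue_measure R D)%E).
    by apply: (congr1 fine); exact: (integral_cst lebesgue_measure mD 1%E).
  by rewrite mul1e lebesgue_measure_itv/= lte_fin d0 oppr0 adde0.
rewrite D1 ler_pdivlMl// in le1.
have := rtorus_int_subset (bounded_ge0_pow_norm H) mD measurableT (@subsetT _ D).
by apply: lt_le_trans; apply: lt_le_trans le1; rewrite mulr_gt0.
Qed.

Lemma full_concentration_with_gap : concentrates_at 2^-1 ->
  full_p_concentration_with_gap p.
Proof.
move=> half c E N c1 sE E0 _.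
have [tE oE symE] := sE.
have [n [m Em]] := open_dyadic oE E0.
(* A negative [c] is replaced by 0, which gives a stronger inequality. *)
have c'0 : 0 <= Num.max c 0 by rewrite le_max lexx orbT.
have c'1 : Num.max c 0 < 1 by rewrite gt_max c1 ltr01.
have [H [H0 gH cH]] := @concentrates_at_dyadic n m half _ _ N c'0 c'1 sE Em.
exists (exp_sum H); first by exists H.
apply/concentratedE; first exact: open_measurable.
apply: le_trans cH; apply: ler_wpM2r; last by rewrite le_max lexx.
by apply: rtorus_int_ge0 => x; exact: powR_ge0.
Qed.

(** Testing on the whole torus, where the integral is positive, bounds admissible constants by 1;
    full concentration makes every [c] in [[0, 1[] admissible. *)
Lemma concentration_constant1 : full_p_concentration_with_gap p ->
  concentration_constant p = 1.
Proof.
move=> full; rewrite /concentration_constant; set S := [set c | _].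
have S1 : ubound S 1.
  move=> c [c0 /(_ setT)[]].
  - by split=> //; exact: openT.
  - by exists 0.
  - move=> _ [H H0 ->] /concentratedE - /(_ measurableT).
    by rewrite ger_pMl// rtorus_int_pow_norm_gt0.
have Sc c : 0 <= c -> c < 1 -> S c.
  move=> c0 c1; split=> // E sE E0.
  have [_ [H [H0 -> _]] cH] := full c E 1%N c1 sE E0 isT.
  by exists (exp_sum H) => //; exists H.
have S0 : S 0 by apply: Sc.
have hS : has_sup S by split; [exists 0|exists 1].
apply/eqP; rewrite eq_le; apply/andP; split.
  by apply: ge_sup => //; exists 0.
rewrite leNgt; apply/negP => sup1.
have sup0 : 0 <= sup S by apply: ub_le_sup => //; exists 1.
(* If the supremum were below 1, its midpoint with 1 would be admissible and exceed it. *)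
have /(Sc _ _) : (1 + sup S) / 2 < 1 by lra.
move=> /(_ _)/(ub_le_sup (ex_intro _ 1 S1)) - /(_ _); lra.
Qed.

End Concentration.

Theorem proposition12 (R : realType) (p : R) (p_gt0 : 0 < p)
    (half : full_p_concentration_with_gap_at_half p) :
  [/\ p_concentration p,
      concentration_constant p = 1
    & full_p_concentration_with_gap p].
Proof.
have conc : concentrates_at p 2^-1.
  move=> c E N c0 c1 sE Eh; have [_ oE _] := sE.
  (* [concentrates_at] allows [N = 0] while [half] wants a positive bound; gaps larger than [N.+1]
     are larger than [N]. *)
  have [_ [H [H0 -> gH]] cH] := half c E N.+1 c1 sE Eh isT.
  exists H; split=> //; first exact: gaps_larger_bound gH.
  by apply/concentratedE => //; exact: open_measurable.
have full := full_concentration_with_gap p_gt0 conc.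
have cp1 := concentration_constant1 p_gt0 full.
by split=> //; rewrite /p_concentration cp1.
Qed.
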